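(* Let $p$ be an odd prime and $r\ge 1$ an integer. For $n\ge 4$ consider the authentication code with source state space $\mathscr{S}=\mathbb{F}_{p^n}$, key space $\mathbb{F}_{p^n}$, message space $\mathscr{M}=\mathbb{F}_{p^n}\times\mathbb{F}_p$ and encoding rules $E_k(s)=(s+k^{p^r},\operatorname{Tr}(sk))$. Then the code asymptotically meets the combinatorial lower bounds $P_I\ge |\mathscr{S}|/|\mathscr{M}|$ and $P_S\ge(|\mathscr{S}|-1)/(|\mathscr{M}|-1)$, i.e. $$\lim_{n\to\infty}\frac{|\mathscr{S}|/|\mathscr{M}|}{P_I}=1\qquad\text{and}\qquad \lim_{n\to\infty}\frac{(|\mathscr{S}|-1)/(|\mathscr{M}|-1)}{P_S}=1 .$$
   Context: $\operatorname{Tr}$ is the absolute trace from $\mathbb{F}_{p^n}$ to $\mathbb{F}_p$. Source states and keys are uniformly distributed. The receiver holding key $k$ accepts a message $(m_1,m_2)$ iff $\operatorname{Tr}((m_1-k^{p^r})k)=m_2$. The maximum success probability of impersonation attack is $$P_I=\max_{a\in\mathbb{F}_{p^n},\,b\in\mathbb{F}_p}\frac{|\{x\in\mathbb{F}_{p^n}:\operatorname{Tr}(ax-x^{p^r+1})=b\}|}{p^n},$$ and the maximum success probability of substitution attack (replacing an observed message $(m_1,m_2)$ by $(m_1',m_2')$ with $m_1'\neq m_1$) is $$P_S=\max_{\substack{\alpha\in\mathbb{F}_{p^n}\setminus\{0\},\ a\in\mathbb{F}_{p^n}\\ b,\beta\in\mathbb{F}_p}}\frac{|\{x\in\mathbb{F}_{p^n}:\operatorname{Tr}(ax-x^{p^r+1})=b,\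 \operatorname{Tr}(\alpha x)=\beta\}|}{|\{x\in\mathbb{F}_{p^n}:\operatorname{Tr}(ax-x^{p^r+1})=b\}|}.$$ Both depend on $n$ (and on $p,r$). *)

(* Defs.v *)
From HB Require Import structures.
From mathcomp Require Import all_boot all_order all_fingroup all_algebra.
From mathcomp Require Import all_solvable all_field.
From mathcomp Require Import all_classical all_reals all_analysis.

Set Implicit Arguments.
Unset Strict Implicit.
Unset Printing Implicit Defensive.

Import Order.TTheory GRing.Theory Num.Theory.
Import numFieldNormedType.Exports.

Local Open Scope ring_scope.

Record auth_code := AuthCode {
  source_state : finType;
  key : finType;
  message : finType;
  encode : key -> source_state -> message
}.

Definition impersonation_bound (R : numFieldType) (C : auth_code) : R :=
  #|source_state C|%:R / #|message C|%:R.

Definition substitution_bound (R : numFieldType) (C : auth_code) : R :=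
  (#|source_state C|%:R - 1) / (#|message C|%:R - 1).

Section TraceCode.
Variables (p r : nat) (F : finFieldType) (charF : p \in [pchar F]).

Local Notation L := (pPrimeCharType charF).

(* The Galois trace from F down to its prime field has its values in the line
   1%VS spanned by 1 : F; Tr x is the coordinate of that value, in 'F_p. *)
Definition Tr (x : F) : 'F_p :=
  coord [tuple (1 : L)] ord0 (galTrace 1%AS {:L}%AS x).

Lemma Tr_galTrace (x : F) : (Tr x)%:A = galTrace 1%AS {:L}%AS x.
Proof.
have := mem_galTrace (finField_galois (sub1v {:L}%AS)) (memvf (x : L)).
case/vlineP=> k; rewrite /Tr => ->; rewrite linearZ /=.
have f1 : free [tuple (1 : L)] by rewrite seq1_free oner_eq0.
have c1 : coord [tuple (1 : L)] ord0 1 = 1 by exact: (coord_free ord0 ord0 f1).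
by rewrite c1 [_ * 1]mulr1.
Qed.

Lemma Tr_powers (n : nat) (x : F) : #|F| = (p ^ n)%N ->
  (Tr x)%:A = \sum_(i < n) (x : L) ^+ (p ^ i).
Proof.
move=> cardF; rewrite Tr_galTrace /galTrace.
have p_pr := pcharf_prime charF.
have cFp : #|'F_p| = p by rewrite card_Fp.
have [al /eqP gen Dal] := finField_galois_generator (sub1v {:L}%AS).
rewrite /= dimv1 expn1 cFp in Dal.
have dimL : \dim {:L} = n.
  have := card_vspace (fullv : {vspace L}).
  rewrite cFp => h; apply/eqP; rewrite -(eqn_exp2l _ _ (prime_gt1 p_pr)).
  rewrite -cardF -h; apply/eqP; apply: eq_card => y; exact: memvf.
have oal : #[al]%g = n.
  rewrite orderE -gen -(galois_dim (finField_galois (sub1v {:L}%AS))).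
  by rewrite /= dimL dimv1 divn1.
have Dpow i : (al ^+ i)%g x = (x : L) ^+ (p ^ i).
  elim: i => [|i IH]; first by rewrite expg0 gal_id.
  by rewrite expgSr galM ?memvf // IH Dal ?memvf // expnSr exprM.
have im : 'Gal({:L}%AS / 1%AS)%g = [set (al ^+ val i)%g | i : 'I_n]%SET.
  rewrite gen; apply/setP=> g; apply/cycleP/imsetP => [[i ->]|[i _ ->]].
    have n0 : (0 < n)%N by rewrite -oal order_gt0.
    exists (Ordinal (ltn_pmod i n0)) => //=.
    by rewrite -[in LHS](expg_mod_order al i) oal.
  by exists i.
rewrite im big_imset /=; first by apply: eq_bigr => i _; exact: Dpow.
move=> i j _ _ /eqP; rewrite eq_expg_mod_order oal.
by rewrite !modn_small // => /eqP/val_inj.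
Qed.

Definition trace_code : auth_code :=
  @AuthCode F F (F * 'F_p)%type
    (fun k s => (s + k ^+ (p ^ r), Tr (s * k))).

Definition accepts (k : F) (m : F * 'F_p) : bool :=
  Tr ((m.1 - k ^+ (p ^ r)) * k) == m.2.

Lemma acceptsP (k : key trace_code) (m : message trace_code) :
  reflect (exists s, encode k s = m) (accepts k m).
Proof.
case: m => a b; apply: (iffP eqP) => /= [<-|[s [<- <-]]].
  by exists (a - k ^+ (p ^ r)); rewrite subrK.
by rewrite addrK.
Qed.

Definition accepting_keys (a : F) (b : 'F_p) : {set F} :=
  [set x : F | Tr (a * x - x ^+ (p ^ r + 1)) == b].

Lemma mem_accepting_keys (a : F) (b : 'F_p) (x : F) :
  (x \in accepting_keys a b) = accepts x (a, b).
Proof. by rewrite inE /accepts /= mulrBl addn1 exprSr. Qed.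

Definition P_I (R : numFieldType) : R :=
  \big[Num.max/0]_(a : F) \big[Num.max/0]_(b : 'F_p)
    (#|accepting_keys a b|%:R / #|F|%:R).

(* (alpha, beta) is the difference between the substituted message and the
   observed message (a, b). An observed message that no key accepts contributes
   _ / 0 = 0, hence does not affect the maximum. *)
Definition P_S (R : numFieldType) : R :=
  \big[Num.max/0]_(alpha : F | alpha != 0) \big[Num.max/0]_(a : F)
  \big[Num.max/0]_(b : 'F_p) \big[Num.max/0]_(beta : 'F_p)
    (#|[set x in accepting_keys a b | Tr (alpha * x) == beta]|%:R
       / #|accepting_keys a b|%:R).

Lemma accepts_substituted (a alpha : F) (b beta : 'F_p) (x : F) :
  (x \in [set x in accepting_keys a b | Tr (alpha * x) == beta]) =
  accepts x (a, b) && accepts x (a + alpha, b + beta).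
Proof.
have TrD (y z : F) : Tr (y + z) = Tr y + Tr z.
  by rewrite /Tr (raddfD (galTrace 1%AS {:L}%AS) y z) raddfD.
rewrite inE mem_accepting_keys; apply: andb_id2l; rewrite /accepts /= => /eqP <-.
by rewrite addrAC mulrDl TrD (inj_eq (addrI _)).
Qed.

End TraceCode.

(* Main.v *)
(** Let [q = #|F|] and [f x = Tr (a * x - x ^+ (p ^ r + 1))]. For fixed [z] the
    difference [f (x + z) - f x] is affine in [x], and nonconstant unless
    [z ^+ (p ^ (2 * r)) + z = 0], which has at most [p ^ (2 * r)] solutions
    whatever [n] is. Counting the collisions of [x |-> (f x, Tr (alpha * x))]
    along [x, x + z] thus gives at most [q ^ 2 / p ^ 2 + p ^ (2 * r) * q] of them,
    and a collision count that exceeds [q ^ 2 / p ^ 2] by [D] forces each of the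
    [p ^ 2] fibres to have [q / p ^ 2] elements up to an error [sqrt D]. Here that
    error is [p ^ r * sqrt q], which is negligible as [n] grows, so that [p * P_I]
    and [p * P_S] both tend to 1. *)

Require Import Defs.
From HB Require Import structures.
From mathcomp Require Import all_boot all_order all_fingroup all_algebra.
From mathcomp Require Import all_solvable all_field.
From mathcomp Require Import all_classical all_reals all_analysis.
From mathcomp Require Import ring.

Set Implicit Arguments.
Unset Strict Implicit.
Unset Printing Implicit Defensive.

Import Order.TTheory GRing.Theory Num.Theory.
Import numFieldNormedType.Exports.

Local Open Scope ring_scope.

(** * Fibre sizes from collision counts *)

Section Fibres.
Variables (X Y : finType) (phi : X -> Y).

Local Notation fibre y := [set x | phi x == y]%SET.

Lemma sum_card_fibre : (\sum_y #|fibre y|)%N = #|X|.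
Proof.
rewrite -sum1_card (partition_big phi predT) //=; apply: eq_bigr => y _.
by rewrite -sum1_card; apply: eq_bigl => x; rewrite inE.
Qed.

Lemma sum_card_fibre_sqr :
  (\sum_y #|fibre y| ^ 2)%N = #|[set u : X * X | phi u.1 == phi u.2]%SET|.
Proof.
rewrite -sum1_card (partition_big (fun u : X * X => phi u.1) predT) //=.
apply: eq_bigr => y _; rewrite -mulnn -cardsX -sum1_card.
apply: eq_bigl => -[x x']; rewrite !inE /= andbC eq_sym.
by case: (phi x =P y) => [->|]; rewrite ?andbF // eq_sym.
Qed.

(* The collision count is the sum of the squared fibre sizes, so the hypothesis
   bounds the sum over [y] of all the squared deviations by [D]. *)
Lemma fibre_deviation (R : realFieldType) (D : R) :
  #|[set u : X * X | phi u.1 == phi u.2]%SET|%:R <= #|X|%:R ^+ 2 / #|Y|%:R + D ->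
  forall y, (#|fibre y|%:R - #|X|%:R / #|Y|%:R) ^+ 2 <= D.
Proof.
move=> le_coll y0; set N := fun y => #|fibre y|%:R : R; set q := #|X|%:R : R.
have Y0 : #|Y|%:R != 0 :> R by rewrite pnatr_eq0 -lt0n; apply/card_gt0P; exists y0.
have sumN : \sum_y N y = q by rewrite -natr_sum sum_card_fibre.
have sumN2 : \sum_y N y ^+ 2 = #|[set u : X * X | phi u.1 == phi u.2]%SET|%:R.
  by rewrite -sum_card_fibre_sqr natr_sum; apply: eq_bigr => y _; rewrite natrX.
(* As [N] has mean [q / #|Y|], expanding the square leaves the collision count minus
   [q ^+ 2 / #|Y|]. *)
have : \sum_y (N y - q / #|Y|%:R) ^+ 2 <= D.
  under eq_bigr do rewrite sqrrB.
  rewrite big_split sumrB /= sumN2 sumr_const sumrMnl -mulr_suml sumN.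
  rewrite -(lerD2l (q ^+ 2 / #|Y|%:R)) (le_trans _ le_coll) //.
  rewrite le_eqVlt; apply/orP; left; apply/eqP; rewrite -mulr_natr.
  by field.
rewrite (bigD1 y0) //=; apply: le_trans; rewrite lerDl.
by apply: sumr_ge0 => y _; apply: sqr_ge0.
Qed.

End Fibres.

(** * The trace to the prime field *)

Section Trace.
Variables (p : nat) (F : finFieldType) (charF : p \in [pchar F]).

Local Notation L := (pPrimeCharType charF).
Local Notation Tr := (Tr charF).

Lemma TrB : {morph Tr : x y / x - y}.
Proof.
by move=> x y; rewrite /Defs.Tr (raddfB (galTrace 1%AS {:L}%AS) x y) raddfB.
Qed.

HB.instance Definition _ := GRing.isZmodMorphism.Build F 'F_p Tr TrB.

(** The trace is a sum of distinct automorphisms with coefficients 1, which cannot vanish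
    identically by Dedekind independence. *)
Lemma Tr_neq0 : exists x, Tr x != 0.
Proof.
have [x _ Tx] := @gal_independent_contra _ L {:L}%AS
  (mem 'Gal({:L}%AS / 1%AS)%g) (fun=> 1) 1%g (group1 _) (oner_neq0 _).
exists x; apply: contraNneq Tx => Tx0; have := Tr_galTrace charF x.
rewrite Tx0 scale0r => T0; apply/eqP; rewrite [RHS]T0.
by apply: eq_bigr => y _; rewrite mul1r.
Qed.

(** Raising to the power [p] permutes the terms [x ^+ (p ^ i)] of the trace cyclically, because
    [x ^+ (p ^ n) = x]. *)
Lemma Tr_frobenius (n k : nat) (x : F) : #|F| = (p ^ n)%N -> Tr (x ^+ (p ^ k)) = Tr x.
Proof.
move=> cardF; elim: k => [|k IH]; first by rewrite expr1.
rewrite expnSr exprM -IH; move: (x ^+ _) => {x IH}x.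
have n0 : (0 < n)%N.
  by case: n cardF (finNzRing_gt1 F) => // ->.
have Tr_powers y := Tr_powers charF y cardF.
apply/eqP; rewrite -subr_eq0 -[_ == 0]orbF -(oner_eq0 L) -scaler_eq0 scalerBl.
rewrite !Tr_powers subr_eq0; case: n n0 cardF {Tr_powers} => // n _ cardF.
rewrite big_ord_recr big_ord_recl /= addrC expn0 expr1 -exprM -expnS -cardF expf_card.
by apply/eqP; congr (_ + _); apply: eq_bigr => i _; rewrite -exprM -expnS.
Qed.

(** The map [x |-> Tr (g * x)] is additive and onto, so its [p] fibres are translates of one
    another. *)
Lemma card_Tr_fibre (g : F) (c : 'F_p) : g != 0 ->
  (p * #|[set x | Tr (g * x)%R == c]%SET|)%N = #|F|.
Proof.
move=> g0; have p_pr := pcharf_prime charF; have [x0 x0P] := Tr_neq0.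
(* The scalar [d / Tr x0] is read as a natural multiple, so additivity of [Tr] suffices. *)
have [x Tx] : exists x, forall d, Tr (g * (x d)) = d :> 'F_p.
  exists (fun d : 'F_p => g^-1 * (x0 *+ (d / Tr x0)%R)) => d.
  by rewrite mulVKf // raddfMn -mulr_natr natr_Zp mulrC divfK.
rewrite -(sum_card_fibre (fun x => Tr (g * x))) -{1}(card_Fp p_pr) -sum_nat_const.
apply: eq_bigr => d _; rewrite -(card_imset _ (addrI (x (d - c)))).
apply: eq_card => y; rewrite inE; apply/imsetP/eqP => [[z + ->]|Ty].
  by rewrite inE => /eqP Tz; rewrite mulrDr raddfD /= Tx Tz subrK.
exists (y - x (d - c)); last by rewrite addrC subrK.
by rewrite inE mulrBr raddfB /= Tx Ty subKr.
Qed.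

Lemma pcharXD (k : nat) : {morph (fun x : F => x ^+ (p ^ k)) : x y / x + y}.
Proof.
move=> x y; apply: exprDn_pchar.
by rewrite pnatX (eq_pnat _ (pcharf_eq charF)) pnat_id ?(pcharf_prime charF).
Qed.

End Trace.

(** * Derivatives of [f] and collisions of the joint map *)

Section Deviation.
Variables (p r n : nat) (F : finFieldType) (charF : p \in [pchar F]).
Hypotheses (r_gt0 : (0 < r)%N) (cardF : #|F| = (p ^ n)%N).
Variables (a alpha : F) (alpha_neq0 : alpha != 0).

Local Notation Tr := (Tr charF).

Let f x := Tr (a * x - x ^+ (p ^ r + 1)).

(* With [w ^+ (p ^ r) = z], the cross term [Tr (z * x ^+ (p ^ r))] is
   [Tr ((w * x) ^+ (p ^ r)) = Tr (w * x)], which makes [g = w + z ^+ (p ^ r)]. *)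
Lemma derivative_affine (z : F) : exists2 g : F,
  g ^+ (p ^ r) = z ^+ (p ^ (r + r)) + z &
  forall x, f (x + z) - f x = f z - Tr (g * x).
Proof.
have frob_inj : injective (fun x : F => x ^+ (p ^ r)).
  move=> x y; rewrite -{1}(subrK y x) (pcharXD charF) -[RHS]add0r => /addIr/eqP.
  by rewrite expf_eq0 subr_eq0 => /andP[_ /eqP].
have [w wz] : exists w, w ^+ (p ^ r) = z.
  by exists (invF frob_inj z); exact: (f_invF frob_inj z).
exists (w + z ^+ (p ^ r)); first by rewrite (pcharXD charF) wz expnD exprM addrC.
move=> x.
have -> : Tr ((w + z ^+ (p ^ r)) * x) = Tr (z * x ^+ (p ^ r) + z ^+ (p ^ r) * x).
  by rewrite mulrDl !raddfD /= -{2}wz -exprMn (Tr_frobenius _ _ _ cardF).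
rewrite /f -!raddfB /= addn1 !exprSr (pcharXD charF).
by congr Tr; ring.
Qed.

Lemma card_radical :
  (#|[set z : F | (z ^+ (p ^ (r + r)) + z == 0)%R]| <= p ^ (r + r))%N.
Proof.
(* This makes ['X] the lower-degree term of the polynomial whose roots are counted. *)
have m1 : (1 < p ^ (r + r))%N.
  by rewrite -[1%N](expn0 p) ltn_exp2l ?prime_gt1 ?(pcharf_prime charF) // addn_gt0 r_gt0.
have size_m : size ('X^(p ^ (r + r)) + 'X : {poly F}) = (p ^ (r + r)).+1.
  by rewrite size_polyDl size_polyXn // size_polyX.
rewrite cardE -ltnS -size_m; apply: max_poly_roots; last exact: enum_uniq.
  by rewrite -size_poly_eq0 size_m.
apply/allP => z; rewrite mem_enum inE => /eqP z0.
by rewrite rootE !hornerE z0.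
Qed.

Lemma card_collisions :
  (p ^ 2 * #|[set u : F * F | ((f u.1, Tr (alpha * u.1)) == (f u.2, Tr (alpha * u.2)))%R]|
    <= #|F| ^ 2 + p ^ 2 * (p ^ (r + r) * #|F|))%N.
Proof.
set C := #|_|; set q := #|F|.
pose K := [set z | Tr (alpha * z) == 0]%SET.
pose Rd := [set z : F | z ^+ (p ^ (r + r)) + z == 0]%SET.
have cardK : (p * #|K|)%N = q by exact: card_Tr_fibre.
(* The collisions [(x, x + z)] of difference [z]: by additivity the second coordinate agrees iff
   [Tr (alpha * z) = 0]. *)
pose c z := #|[set x | (f x == f (x + z)) && (Tr (alpha * z) == 0)]%SET|.
have -> : C = (\sum_z c z)%N.
  rewrite /C -sum1_card (partition_big (fun u : F * F => u.2 - u.1) predT) //=.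
  apply: eq_bigr => z _; rewrite /c sum1dep_card.
  rewrite -(card_imset (f := fun x => (x, x + z))); last by move=> x y [].
  apply: eq_card => -[x y]; rewrite !inE /= xpair_eqE.
  apply/idP/imsetP => [/andP[/andP[fxy Txy] /eqP <-]|[x' + [-> ->]]].
    exists x; last by rewrite addrC subrK.
    by rewrite inE addrC subrK fxy mulrBr raddfB /= (eqP Txy) subrr eqxx.
  rewrite inE => /andP[-> /eqP Tz].
  by rewrite mulrDr raddfD /= Tz addr0 eqxx addrAC subrr add0r eqxx.
(* For [z] in [Rd] the trivial bound [q] is used; outside [K] there is no collision; otherwise
   collisions solve [Tr (g * x) = f z] with [g != 0], which has [q / p] solutions. *)
have le_c z : (p * c z <= (z \in K) * q + p * ((z \in Rd) * q))%N.
  have [zRd|zRd] := boolP (z \in Rd).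
    by rewrite mul1n (leq_trans _ (leq_addl _ _)) // leq_mul2l max_card orbT.
  have [zK|zK] := boolP (z \in K); last first.
    rewrite /c eq_card0 ?muln0 // => x; move: zK; rewrite !inE => /negbTE->.
    by rewrite andbF.
  have [g gz Df] := derivative_affine z.
  have g0 : g != 0.
    apply: contraNneq zRd => g0; rewrite inE -gz g0 expr0n expn_eq0.
    by case: p (pcharf_prime charF).
  rewrite !mul0n muln0 addn0 mul1n -[q](card_Tr_fibre charF (f z) g0) leq_mul2l.
  apply/orP; right; apply/subset_leq_card/fintype.subsetP => x.
  rewrite !inE => /andP[/eqP fx _].
  by rewrite eq_sym -subr_eq0 -Df -fx subrr.
(* One factor [p] is absorbed by [le_c], the other by [p * #|K| = q]. *)
rewrite expnS expn1 -!mulnA big_distrr /= (leq_trans (n := p * (#|K| * q + p * (#|Rd| * q)))) //.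
  rewrite leq_mul2l; apply/orP; right.
  have sum_mem (A : {set F}) : (\sum_z (z \in A))%N = #|A|.
    by rewrite -sum1_card [RHS]big_mkcond; apply: eq_bigr => z _; case: (z \in A).
  apply: (@leq_trans (\sum_z ((z \in K) * q + p * ((z \in Rd) * q)))%N).
    by apply: leq_sum => z _; exact: le_c.
  by rewrite big_split /= -big_distrr /= -!big_distrl /= !sum_mem.
rewrite mulnDr mulnA cardK leq_add2l !leq_mul2l leq_mul2r card_radical.
by rewrite !orbT.
Qed.

(** The fibre estimate with [D = p ^ (r + r) * q], whose square root is [p ^ r * sqrt q]. *)
Lemma joint_deviation (R : rcfType) (b beta : 'F_p) :
  `|#|[set x in accepting_keys r charF a b | Tr (alpha * x) == beta]%SET|%:R
     - #|F|%:R / (p ^ 2)%:R| <= (p ^ r)%:R * Num.sqrt #|F|%:R :> R.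
Proof.
have p_pr := pcharf_prime charF.
have p2 : 0 < (p ^ 2)%:R :> R by rewrite ltr0n expn_gt0 prime_gt0.
have : #|[set u : F * F | (f u.1, Tr (alpha * u.1)) == (f u.2, Tr (alpha * u.2))]%SET|%:R
    <= #|F|%:R ^+ 2 / #|{: 'F_p * 'F_p}|%:R + (p ^ (r + r) * #|F|)%:R :> R.
  rewrite card_prod !card_Fp // mulnn -(ler_pM2l p2) mulrDr mulrCA divff ?gt_eqF //.
  by rewrite mulr1 -natrX -!natrM -natrD ler_nat card_collisions.
move=> /(@fibre_deviation _ _ (fun x => (f x, Tr (alpha * x))))/(_ (b, beta)); rewrite card_prod !card_Fp // mulnn => dev.
rewrite -ler_sqr ?nnegrE ?mulr_ge0 ?sqrtr_ge0 ?normr_ge0 ?ler0n //.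
rewrite real_normK ?num_real // exprMn sqr_sqrtr ?ler0n // -natrX -natrM -expnM muln2 -addnn.
rewrite (le_trans _ dev) // le_eqVlt; apply/orP; left; apply/eqP.
congr ((_%:R - _) ^+ 2); apply: eq_card => x.
by rewrite !inE xpair_eqE.
Qed.

End Deviation.

(** * Two-sided bounds on [P_I] and [P_S] for fixed [n] *)

Section Bounds.
Variables (R : rcfType) (p r n : nat) (F : finFieldType) (charF : p \in [pchar F]).
Hypotheses (r_gt0 : (0 < r)%N) (cardF : #|F| = (p ^ n)%N).

Local Notation Tr := (Tr charF).

(* The relative error: [p ^ r * sqrt q = delta * (q / p ^ 2)]. *)
Let delta : R := p%:R ^+ r.+2 / Num.sqrt #|F|%:R.
Let q : R := #|F|%:R.

Let p_gt0 : 0 < p%:R :> R. Proof. by rewrite ltr0n prime_gt0 ?(pcharf_prime charF). Qed.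
Let q_gt0 : 0 < q. Proof. by rewrite ltr0n (leq_trans _ (finNzRing_gt1 F)). Qed.

Lemma card_joint_bounds (a alpha : F) (b beta : 'F_p) : alpha != 0 ->
  (1 - delta) * (q / p%:R ^+ 2)
    <= #|[set x in accepting_keys r charF a b | Tr (alpha * x) == beta]%SET|%:R
    <= (1 + delta) * (q / p%:R ^+ 2).
Proof.
move=> alpha0; have := joint_deviation charF r_gt0 cardF a alpha0 R b beta.
have -> : (p ^ r)%:R * Num.sqrt #|F|%:R = delta * (q / p%:R ^+ 2) :> R.
  have s_gt0 : 0 < Num.sqrt q by rewrite sqrtr_gt0.
  have -> : q = Num.sqrt q ^+ 2 by rewrite sqr_sqrtr // ltW.
  rewrite /delta -/q natrX !exprS; field.
  by rewrite !gt_eqF.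
by rewrite natrX -/q ler_distl mulrBl mulrDl mul1r.
Qed.

(** The values of [Tr (1 * x)] cut the accepting keys into [p] slices, and the joint estimates for
    [alpha = 1] add up. *)
Lemma card_accepting_bounds (a : F) (b : 'F_p) :
  (1 - delta) * (q / p%:R) <= #|accepting_keys r charF a b|%:R <= (1 + delta) * (q / p%:R).
Proof.
have -> : #|accepting_keys r charF a b|%:R = \sum_(beta : 'F_p)
    #|[set x in accepting_keys r charF a b | Tr (1 * x) == beta]%SET|%:R :> R.
  rewrite -natr_sum; congr _%:R; rewrite -sum1_card.
  rewrite (partition_big (fun x => Tr (1 * x)) predT) //=; apply: eq_bigr => beta _.
  by rewrite -sum1_card; apply: eq_bigl => x; rewrite [RHS]inE.
have sum_const c : c * (q / p%:R) = \sum_(beta : 'F_p) c * (q / p%:R ^+ 2) :> R.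
  rewrite sumr_const card_Fp ?(pcharf_prime charF) // -mulr_natr.
  by field; rewrite gt_eqF.
rewrite !sum_const; apply/andP; split; apply: ler_sum => beta _;
  by case/andP: (card_joint_bounds a b beta (oner_neq0 F)).
Qed.

Lemma P_I_bounds : 1 - delta <= p%:R * P_I r charF R <= 1 + delta.
Proof.
have d0 : 0 <= delta by rewrite divr_ge0 ?sqrtr_ge0 ?exprn_ge0 ?ler0n.
have divpq c : p%:R^-1 * c * q = c * (q / p%:R) by ring.
rewrite -ler_pdivrMl // -ler_pdivlMl //; apply/andP; split.
  (* Any one term bounds the maximum from below; [a = b = 0] is taken. *)
  apply: (le_trans _ (le_bigmax _ _ 0)); apply: (le_trans _ (le_bigmax _ _ 0)).
  by rewrite ler_pdivlMr // divpq; case/andP: (card_accepting_bounds 0 0).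
apply: bigmax_le => [|a _]; first by rewrite mulr_ge0 ?invr_ge0 ?ler0n ?addr_ge0.
apply: bigmax_le => [|b _]; first by rewrite mulr_ge0 ?invr_ge0 ?ler0n ?addr_ge0.
by rewrite ler_pdivrMr // divpq; case/andP: (card_accepting_bounds a b).
Qed.

Lemma P_S_bounds : delta < 1 ->
  (1 - delta) / (1 + delta) <= p%:R * P_S r charF R <= (1 + delta) / (1 - delta).
Proof.
move=> d1; have d0 : 0 <= delta by rewrite divr_ge0 ?sqrtr_ge0 ?exprn_ge0 ?ler0n.
have dB : 0 < 1 - delta by rewrite subr_gt0.
have dD : 0 < 1 + delta by rewrite ltr_wpDr.
(* Since [delta < 1], every message is accepted by some key, so no ratio has denominator 0. *)
have N_gt0 a b : 0 < #|accepting_keys r charF a b|%:R :> R.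
  case/andP: (card_accepting_bounds a b) => + _; apply: lt_le_trans.
  by rewrite mulr_gt0 ?divr_gt0.
have cancel_factor (x y : R) : y != 0 ->
    p%:R^-1 * (x / y) * (y * (q / p%:R)) = x * (q / p%:R ^+ 2).
  by move=> y0; field; rewrite y0 gt_eqF.
have pV_gt0 (x y : R) : 0 < x -> 0 < y -> 0 < p%:R^-1 * (x / y).
  by move=> x0 y0; rewrite mulr_gt0 ?divr_gt0 ?invr_gt0.
rewrite -ler_pdivrMl // -ler_pdivlMl //; apply/andP; split.
  apply: (le_trans _ (@le_bigmax_cond _ _ F 0 1 (fun alpha => alpha != 0) _ (oner_neq0 F))).
  do 3 apply: (le_trans _ (le_bigmax _ _ 0)).
  rewrite ler_pdivlMr //.
  case/andP: (card_joint_bounds 0 0 0 (oner_neq0 F)) => + _; apply: le_trans.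
  case/andP: (card_accepting_bounds 0 0) => _ le_N.
  by rewrite -(@cancel_factor _ (1 + delta)) ?gt_eqF // ler_wpM2l // ltW ?pV_gt0.
have B0 : 0 <= p%:R^-1 * ((1 + delta) / (1 - delta)) by rewrite ltW ?pV_gt0.
apply: bigmax_le => // alpha alpha0; apply: bigmax_le => // a _.
apply: bigmax_le => // b _; apply: bigmax_le => // beta _.
rewrite ler_pdivrMr //.
case/andP: (card_joint_bounds a b beta alpha0) => _ /le_trans; apply.
rewrite -(@cancel_factor _ (1 - delta)) ?gt_eqF // ler_wpM2l //.
by case/andP: (card_accepting_bounds a b).
Qed.

End Bounds.

(** * Passage to the limit *)

Local Open Scope classical_set_scope.

Theorem theorem3 (R : realType) (p r : nat) (p_prime : prime p)
  (p_odd : odd p) (r_ge1 : (1 <= r)%N)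
  (F : nat -> finFieldType)
  (charF : forall n, p \in [pchar F n])
  (cardF : forall n, (4 <= n)%N -> #|F n| = (p ^ n)%N) :
  ((fun n => impersonation_bound R (trace_code r (charF n))
               / P_I r (charF n) R) @ \oo --> (1 : R)) /\
  ((fun n => substitution_bound R (trace_code r (charF n))
               / P_S r (charF n) R) @ \oo --> (1 : R)).
Proof.
have p_gt0 : 0 < p%:R :> R by rewrite ltr0n prime_gt0.
pose q n : R := #|F n|%:R; pose delta n : R := p%:R ^+ r.+2 / Num.sqrt (q n).
(* For [n >= 4], [1 / q n = s ^+ (2 * n)] and [delta n = p ^ (r + 2) * s ^+ n], so both decay
   geometrically. *)
pose s : R := (Num.sqrt p%:R)^-1.
have s0 : 0 < s by rewrite invr_gt0 sqrtr_gt0.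
have s1 : s < 1.
  by rewrite invf_lt1 ?sqrtr_gt0 // -{1}[1]sqrtr1 ltr_sqrt // ltr1n prime_gt1.
have qVE n : (4 <= n)%N -> (q n)^-1 = (s ^+ n) ^+ 2.
  move=> n4; rewrite exprAC /q cardF // natrX -exprVn; congr (_ ^+ _).
  by rewrite exprVn sqr_sqrtr // ltW.
have sX0 : s ^+ n @[n --> \oo] --> (0 : R) by apply: cvg_expr; rewrite gtr0_norm.
have q_large : \forall n \near \oo, (4 <= n)%N by exists 4%N.
have qV0 : (q n)^-1 @[n --> \oo] --> (0 : R).
  rewrite -[X in _ --> X](mulr0 0).
  apply: cvg_trans (cvgM sX0 sX0); apply: near_eq_cvg.
  near=> n; have n4 : (4 <= n)%N by near: n.
  by rewrite qVE // expr2.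
have delta0 : delta n @[n --> \oo] --> (0 : R).
  rewrite -[X in _ --> X](mulr0 (p%:R ^+ r.+2)).
  apply: cvg_trans (cvgM (cvg_cst (p%:R ^+ r.+2 : R)) sX0); apply: near_eq_cvg.
  near=> n; have n4 : (4 <= n)%N by near: n.
  rewrite /delta; congr (_ * _).
  by rewrite -sqrtrV ?qVE // ?sqrtr_sqr ?gtr0_norm ?exprn_gt0.
have dB : 1 - delta n @[n --> \oo] --> (1 : R).
  rewrite -[X in _ --> X]subr0; apply: cvgB => //; exact: cvg_cst.
have dD : 1 + delta n @[n --> \oo] --> (1 : R).
  rewrite -[X in _ --> X]addr0; apply: cvgD => //; exact: cvg_cst.
have cvg_ratio (u v : nat -> R) : u n @[n --> \oo] --> (1 : R) ->
    v n @[n --> \oo] --> (1 : R) -> u n / v n @[n --> \oo] --> (1 : R).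
  move=> u1 v1; rewrite -[X in _ --> X]divr1.
  by apply: cvgM => //; apply: cvgV => //; exact: oner_neq0.
have PI1 : p%:R * P_I r (charF n) R @[n --> \oo] --> (1 : R).
  apply: squeeze_cvgr dB dD; near=> n.
  by apply: (@P_I_bounds R p r n) => //; rewrite cardF //; near: n.
have PS1 : p%:R * P_S r (charF n) R @[n --> \oo] --> (1 : R).
  apply: squeeze_cvgr (cvg_ratio _ _ dB dD) (cvg_ratio _ _ dD dB); near=> n.
  apply: (@P_S_bounds R p r n) => //; first by rewrite cardF //; near: n.
  by near: n; apply: cvgr_lt delta0 _ ltr01.
have bI1 n : p%:R * impersonation_bound R (trace_code r (charF n)) = 1.
  rewrite /impersonation_bound card_prod card_Fp // natrM; field.
  by rewrite gt_eqF // pnatr_eq0 -lt0n (leq_trans _ (finNzRing_gt1 _)).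
have bS1 : p%:R * substitution_bound R (trace_code r (charF n)) @[n --> \oo] --> (1 : R).
  (* This is [p * (q - 1) / (q * p - 1)] with numerator and denominator divided by [q * p]. *)
  have : (1 - (q n)^-1) / (1 - p%:R^-1 * (q n)^-1) @[n --> \oo] --> (1 : R).
    apply: cvg_ratio; rewrite -[X in _ --> X]subr0.
      by apply: cvgB => //; exact: cvg_cst.
    rewrite -[X in _ --> _ - X](mulr0 p%:R^-1).
    by apply: cvgB; [exact: cvg_cst|apply: cvgM => //; exact: cvg_cst].
  apply: cvg_trans; apply: near_eq_cvg; near=> n.
  rewrite /substitution_bound card_prod card_Fp // natrM -/(q n).
  have q1 : 1 < q n by rewrite ltr1n finNzRing_gt1.
  have p1 : 1 < p%:R :> R by rewrite ltr1n prime_gt1.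
  have pq1 : 1 < q n * p%:R by rewrite mulr_egt1.
  by field; rewrite !gt_eqF ?subr_gt0 // (lt_trans ltr01).
(* Each quotient is expanded by [p], after which numerator and denominator both tend to 1. *)
split.
  apply: cvg_trans (cvg_ratio (fun=> 1) _ (cvg_cst _) PI1); apply: near_eq_cvg; near=> n.
  by rewrite -{1}(bI1 n) -mulf_div divff ?mul1r // gt_eqF.
apply: cvg_trans (cvg_ratio _ _ bS1 PS1); apply: near_eq_cvg; near=> n.
by rewrite -mulf_div divff ?mul1r // gt_eqF.
Unshelve. all: by end_near.
Qed.
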